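(* Let $\mu=l_1+l_2$ be a symmetric DGLA structure on a graded vector space $E=\oplus_{i\in\mathbb Z}E_i$ and let $\pi\in E_0$. Then: (1) $\mathrm{Id}_E+\pi$ is a Nijenhuis vector valued form with curvature $\pi$, with respect to $\mu$ and with square itself if, and only if, $\pi$ is a Maurer–Cartan element of the DGLA $(E,\mu)$, i.e. $l_1(\pi)-\tfrac12l_2(\pi,\pi)=0$. (2) Assuming (1) is satisfied, the deformed structure is the curved symmetric DGLA structure $l_1(\pi)+l_2(\pi,\cdot)+l_2$.
   Context: Let $E=\oplus_{i\in\mathbb Z}E_i$ be a graded vector space over $\mathbb R$ or $\mathbb C$; $|X|$ is the degree of homogeneous $X$. A symmetric vector valued $k$-form ($k\ge0$) is a graded symmetric $k$-linear map $K:E^{k}\to E$ (exchanging adjacent arguments $X,Y$ gives the sign $(-1)^{|X||Y|}$); a $0$-form is an element of $E$. It has degree $\bar K$ if $|K(X_1,\dots,X_k)|=|X_1|+\dots+|X_k|+\bar K$. A symmetric vector valued form is a formal sum of $k$-forms, $k\ge0$. For a $k$-form $K$ and $l$-form $L$, $$\iota_KL(X_1,\dots,X_{k+l-1})=\sum_{\sigma\in Sh(k,l-1)}\epsilon(\sigma)L(K(X_{\sigma(1)},\dots,X_{\sigma(k)}),X_{\sigma(k+1)},\dots,X_{\sigma(k+l-1)}),$$ with $Sh(k,l-1)$ the $(k,l-1)$-unshuffles and $\epsilon(\sigma)$ the Koszul sign; $\iota_KL=0$ if $l=0$, and $\iota_KL=L(K,\dots)$ if $k=0$. The Richardson–Nijenhuis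 bracket is $[K,L]_{_{RN}}=\iota_KL-(-1)^{\bar K\bar L}\iota_LK$, extended bilinearly. For $\mu$ of degree $1$, a symmetric vector valued form $\mathcal N$ of degree $0$ is Nijenhuis with respect to $\mu$ with square $\mathcal K$ if $\mathcal K$ has degree $0$, $[\mathcal N,[\mathcal N,\mu]_{_{RN}}]_{_{RN}}=[\mathcal K,\mu]_{_{RN}}$ and $[\mathcal N,\mathcal K]_{_{RN}}=0$; ''with curvature'' means that $\mathcal N$ has a $0$-form component. The deformed structure is $[\mathcal N,\mu]_{_{RN}}$. Symmetric graded Lie bracket: a graded symmetric bilinear map $l_2$ of degree $1$ with $l_2(l_2(X,Y),Z)+(-1)^{|Y||Z|}l_2(l_2(X,Z),Y)+(-1)^{|X|(|Y|+|Z|)}l_2(l_2(Y,Z),X)=0$. Symmetric DGLA structure $l_1+l_2$: such an $l_2$ and a linear map $l_1$ of degree $1$ with $l_1^2=0$ and $l_1(l_2(X,Y))+l_2(l_1X,Y)+(-1)^{|X|}l_2(X,l_1Y)=0$. Curved symmetric DGLA structure $C+\mathrm d+l_2$: $C\in E_1$, $\mathrm d:E\to E$ linear of degree $1$, $l_2$ a symmetric graded Lie bracket of degree $1$, with $\mathrm d(C)=0$, $l_2(C,X)+\mathrm d^2X=0$, and $\mathrm d\,l_2(X,Y)+l_2(\mathrm dX,Y)+(-1)^{|X|}l_2(X,\mathrm dY)=0$. *)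

(* Defs.v *)
From HB Require Import structures.
From mathcomp Require Import all_boot all_order all_algebra all_fingroup.
From mathcomp Require Import boolp classical_sets cardinality fsbigop reals.
From mathcomp Require Import complex.
Set Implicit Arguments.
Unset Strict Implicit.
Unset Printing Implicit Defensive.
Import Order.TTheory GRing.Theory Num.Theory.

Local Open Scope classical_set_scope.
Local Open Scope ring_scope.

Variant scalar_kind := RealScalars | ComplexScalars.

Definition scalars (R : realType) (c : scalar_kind) : numFieldType :=
  match c with
  | RealScalars => R
  | ComplexScalars => R[i]
  end.

(* A direct sum decomposition V = \oplus_(i : int) E_i, given by its component
   maps: [gcomp E i x] is the component of x in E_i, and E_i is the range of
   the idempotent [gcomp E i]. *)
Record grading (K : numFieldType) (V : lmodType K) := Grading {
  gcomp : int -> {linear V -> V};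
  gcomp_ortho : forall i j x,
    gcomp i (gcomp j x) = if i == j then gcomp j x else 0;
  gcomp_finite : forall x, finite_set [set i | gcomp i x != 0];
  gcomp_sum : forall x, \sum_(i \in [set: int]) gcomp i x = x
}.

Definition homog (K : numFieldType) (V : lmodType K) (E : grading V)
  (i : int) : set V := [set x | gcomp E i x = x].

(* A formal sum of k-ary maps V^k -> V, k >= 0: its k-ary part is its
   restriction to the sequences of size k. *)
Definition vform (V : Type) := seq V -> V.

Section Forms.
Variables (K : numFieldType) (V : lmodType K) (E : grading V).
Implicit Types (f g : vform V) (X : seq V).

Definition form0 (c : V) : vform V :=
  fun X => if X is [::] then c else 0.

Definition form1 (u : V -> V) : vform V :=
  fun X => if X is [:: x] then u x else 0.

Definition form2 (b : V -> V -> V) : vform V :=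
  fun X => if X is [:: x; y] then b x y else 0.

Definition multilinear f :=
  forall X Y, linear (fun x => f (X ++ x :: Y)).

Definition graded_symmetric f :=
  forall X Y i j x y, homog E i x -> homog E j y ->
    f (X ++ x :: y :: Y) = (-1) ^ (i * j) *: f (X ++ y :: x :: Y).

(* The first components of the pairs are the degrees of the arguments. *)
Definition has_degree (a : int) f :=
  forall s : seq (int * V), {in s, forall p, homog E p.1 p.2} ->
    homog E (\sum_(p <- s) p.1 + a) (f [seq p.2 | p <- s]).

Definition svform (a : int) f :=
  [/\ multilinear f, graded_symmetric f & has_degree a f].

(* Indices are counted from 0: the two blocks on which an unshuffle is
   increasing are [0, k) and [k, n). *)
Definition unshuffle (k n : nat) (s : 'S_n) : bool :=
  [forall i : 'I_n, forall j : 'I_n,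
     ((i < j < k) || (k <= i < j))%N ==> (s i < s j)%N].

(* Koszul sign of s on arguments of degrees d 0, ..., d (n-1). *)
Definition koszul (n : nat) (d : 'I_n -> int) (s : 'S_n) : K :=
  \prod_(i < n) \prod_(j < n | (i < j)%N && (s j < s i)%N)
    (-1) ^ (d (s i) * d (s j)).

(* The insertion operator \iota_f g.  The Koszul sign only makes sense on
   homogeneous arguments; the inner sum, which has finite support when f and g
   are multilinear, runs over all families d of degrees and replaces each
   argument by its component of degree d, so that this is the multilinear
   extension of the usual formula (see [insertion_homog]).
   On n arguments, the k-ary part of f meets the (n - k + 1)-ary part of g;
   thus the 0-ary part of g never contributes. *)
Definition insertion f g : vform V := fun X =>
  \sum_(k < (size X).+1) \sum_(s : 'S_(size X) | unshuffle k s)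
    \sum_(d \in [set: {ffun 'I_(size X) -> int}])
      let Y := [seq gcomp E (d (s i)) X`_(s i) | i <- enum 'I_(size X)] in
      koszul d s *: g (f (take k Y) :: drop k Y).

(* Richardson-Nijenhuis bracket of f of degree a and g of degree b. *)
Definition rn_bracket (a b : int) f g : vform V := fun X =>
  insertion f g X - (-1) ^ (a * b) *: insertion g f X.

Record nijenhuis (mu N S : vform V) : Prop := Nijenhuis {
  nijenhuis_mu : svform 1 mu;
  nijenhuis_form : svform 0 N;
  nijenhuis_square : svform 0 S;
  nijenhuis_deform : rn_bracket 0 1 N (rn_bracket 0 1 N mu)
    =1 rn_bracket 0 1 S mu;
  nijenhuis_commute : rn_bracket 0 0 N S =1 \0
}.

Definition nijenhuis_with_curvature (mu N S : vform V) (c : V) :=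
  nijenhuis mu N S /\ N [::] = c.

Definition linear_of_degree1 (u : V -> V) :=
  linear u /\ forall i x, homog E i x -> homog E (i + 1) (u x).

Record symmetric_graded_lie (l2 : V -> V -> V) : Prop := SymmetricGradedLie {
  lie_linearl : forall y, linear (l2^~ y);
  lie_linearr : forall x, linear (l2 x);
  lie_degree : forall i j x y, homog E i x -> homog E j y ->
    homog E (i + j + 1) (l2 x y);
  lie_symmetric : forall i j x y, homog E i x -> homog E j y ->
    l2 x y = (-1) ^ (i * j) *: l2 y x;
  lie_jacobi : forall i j k x y z,
    homog E i x -> homog E j y -> homog E k z ->
    l2 (l2 x y) z + (-1) ^ (j * k) *: l2 (l2 x z) y
      + (-1) ^ (i * (j + k)) *: l2 (l2 y z) x = 0
}.

Definition compatible (u : V -> V) (l2 : V -> V -> V) :=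
  forall i x y, homog E i x ->
    u (l2 x y) + l2 (u x) y + (-1) ^ i *: l2 x (u y) = 0.

Record symmetric_dgla (l1 : V -> V) (l2 : V -> V -> V) : Prop :=
  SymmetricDGLA {
  dgla_lie : symmetric_graded_lie l2;
  dgla_differential : linear_of_degree1 l1;
  dgla_square0 : forall x, l1 (l1 x) = 0;
  dgla_compatible : compatible l1 l2
}.

Record curved_symmetric_dgla (C : V) (u : V -> V) (l2 : V -> V -> V) : Prop :=
  CurvedSymmetricDGLA {
  curved_curvature : homog E 1 C;
  curved_differential : linear_of_degree1 u;
  curved_lie : symmetric_graded_lie l2;
  curved_closed : u C = 0;
  curved_square : forall x, l2 C x + u (u x) = 0;
  curved_compatible : compatible u l2
}.

Definition maurer_cartan (l1 : V -> V) (l2 : V -> V -> V) (p : V) :=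
  l1 p - 2^-1 *: l2 p p = 0.

Lemma multilinear0 f X Y : multilinear f -> f (X ++ 0 :: Y) = 0.
Proof.
move=> lf; have := lf X Y (-1) 0 0.
by rewrite scaler0 addr0 scaleN1r addNr.
Qed.

Lemma multilinear_mem0 f X : multilinear f -> 0 \in X -> f X = 0.
Proof. by move=> lf /splitPr[X1 X2]; exact: multilinear0. Qed.

Lemma insertion_homog f g X (d : {ffun 'I_(size X) -> int}) :
    multilinear f -> multilinear g -> (forall i, homog E (d i) X`_i) ->
  insertion f g X =
    \sum_(k < (size X).+1) \sum_(s : 'S_(size X) | unshuffle k s)
      let Y := [seq X`_(s i) | i <- enum 'I_(size X)] in
      koszul d s *: g (f (take k Y) :: drop k Y).
Proof.
move=> lf lg hX; apply: eq_bigr => k _; apply: eq_bigr => s _ /=.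
rewrite -(@fsbig_widen _ _ _ _ [set d]) //=; last first.
  move=> e [_ /= ne].
  have [i nei] : exists i, e (s i) != d (s i).
    case: (pickP (fun i => e (s i) != d (s i))) => [i nei|h]; first by exists i.
    case: ne; apply/ffunP => i; rewrite -(permKV s i).
    by apply/eqP/negbFE/h.
  set Y := map _ _.
  have Y0 : 0 \in Y.
    apply/mapP; exists i; first by rewrite mem_enum.
    by rewrite -(hX (s i)) gcomp_ortho (negbTE nei).
  rewrite -(cat_take_drop k Y) mem_cat in Y0.
  case/orP: Y0 => Y0; last first.
    by rewrite multilinear_mem0 ?scaler0 // inE Y0 orbT.
  by rewrite (multilinear_mem0 lf Y0) multilinear_mem0 ?scaler0 // mem_head.
rewrite fsbig_set1; congr (_ *: g (f (take _ _) :: drop _ _));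
  by apply: eq_map => i; exact: hX.
Qed.

End Forms.

(* Main.v *)
From HB Require Import structures.
Require Import Defs.
From mathcomp Require Import all_boot all_order all_algebra all_fingroup zify.
From mathcomp Require Import boolp classical_sets cardinality fsbigop reals.
Set Implicit Arguments.
Unset Strict Implicit.
Unset Printing Implicit Defensive.
Import Order.TTheory GRing.Theory Num.Theory.
Local Open Scope ring_scope.

(** The whole computation rests on one formula for the bracket with
    [N = Id + p], valid for every multilinear graded symmetric form [f]
    ([rn_bracket_id_const]): on [k] arguments,
      [[N, f](X) = f(p, X) + (k - 1) f(X)].
    Indeed inserting the constant [p] puts it in the first slot; inserting the
    identity in a [k]-form gives one copy of that form for each of the [k]
    unshuffles of type (1, k - 1), the Koszul sign being exactly the sign by
    which graded symmetry moves the chosen argument back to its place; and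
    inserting [f] in the identity gives [f] back.

    Applied to [mu = l1 + l2], the formula gives
    [[N, mu] = l1(p) + l2(p, .) + l2], because the coefficient [k - 1] kills
    [l1] and keeps [l2]; applied once more, it gives
    [[N, [N, mu]] = (l2(p, p) - l1(p)) + l2(p, .) + l2].  The two differ only
    in arity 0, and there their equality [l2(p, p) - l1(p) = l1(p)] is the
    Maurer-Cartan equation.  The other condition on the square, [[N, N] = 0],
    holds because the bracket is antisymmetric on forms of degree 0.

    The curved structure comes from the Jacobi identity with [p] as one of its
    arguments: with [x] and [y] arbitrary it says that [l2 p] is a derivation of
    [l2] ([lie_jacobi_const]); with [x = p] it says that
    [l2(l2(p, p), y) = - 2 l2(p, l2(p, y))], which becomes the curvature
    equation when [l2(p, p)] is replaced by [2 l1(p)]; with [x = y = p] it says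
    that [3 l2(p, l2(p, p)) = 0], whence [l2(p, l1(p)) = 0].  The Jacobi identity
    speaks of homogeneous arguments; the first two consequences reach arbitrary
    [y] by linearity ([linear_homog0]).

    Insertion is defined by a sum over all families of degrees of the
    arguments.  Whenever the Koszul sign has been absorbed by graded symmetry,
    the summand is [f] on the homogeneous components of the arguments, and the
    sum is removed by multilinear expansion ([multilinear_gcomp]). *)

(** * Expansion into homogeneous components *)

(** Turns a finitely supported sum over an infinite type, such as the degrees or
    the families of degrees, into a sum over a finite type that parametrizes
    the support. *)
Lemma fsbig_finite_support (W : nmodType) (I : choiceType) (T : finType)
    (h : T -> I) (F : I -> W) :
    injective h -> (forall i, F i != 0 -> exists t, i = h t) ->
  \sum_(i \in [set: I]%classic) F i = \sum_t F (h t).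
Proof.
move=> hI hF.
rewrite -(@fsbig_widen _ _ _ _ [set h t | t in [set: T]]%classic) //=.
  rewrite fsbig_image; last by move=> x y _ _; exact: hI.
  rewrite (fsbigE (index_enum T)) ?index_enum_uniq//=.
    by apply: eq_bigl => t; exact: mem_set.
  by move=> i _; rewrite mem_index_enum.
move=> i [_ /= ni]; apply/eqP/negPn/negP => /hF [t it].
by apply: ni; exists t.
Qed.

Section Grading.
Variables (K : numFieldType) (V : lmodType K) (E : grading V).

(** A single finite set of degrees serves for all the arguments of a form, so
    that the families of degrees that matter form a finite function type. *)
Lemma common_degrees (X : seq V) : exists J : seq int,
  forall x i, x \in X -> gcomp E i x != 0 -> i \in J.
Proof.
elim: X => [|x X [J hJ]]; first by exists [::].
have /finite_seqP[J' hJ'] := gcomp_finite E x.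
exists (J' ++ J) => y i; rewrite inE mem_cat => /orP[/eqP-> nz|yX nz].
  have : [set` J']%classic i by rewrite -hJ'.
  by move=> /= ->.
by rewrite (hJ y) ?orbT.
Qed.

Lemma gcomp_sum_degrees (J : seq int) x :
    (forall i, gcomp E i x != 0 -> i \in J) ->
  \sum_(t : seq_sub J) gcomp E (val t) x = x.
Proof.
move=> hJ; rewrite -[RHS](gcomp_sum E).
rewrite -(fsbig_finite_support val_inj (F := fun i => gcomp E i x)) //.
by move=> i /hJ iJ; exists (SeqSub iJ).
Qed.

Lemma homog_gcomp i x : homog E i (gcomp E i x).
Proof. by rewrite /homog/= gcomp_ortho eqxx. Qed.

(** Carries consequences of the Jacobi identity, which is about homogeneous
    vectors, over to all vectors. *)
Lemma linear_homog0 (W : lmodType K) (u : V -> W) : linear u ->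
  (forall i x, homog E i x -> u x = 0) -> forall x, u x = 0.
Proof.
move=> lu u0 x; have [J hJ] := common_degrees [:: x].
rewrite -(@gcomp_sum_degrees J x); last by move=> i; apply: hJ; rewrite inE.
pose U := HB.pack u (@GRing.isLinear.Build K V W *:%R u lu) : {linear V -> W}.
rewrite -[u]/(U : V -> W) linear_sum big1// => t _; exact: u0 (homog_gcomp _ _).
Qed.

(** By induction on the arity: linearity expands the first argument, and the
    functions on ['I_n.+1] are the pairs of a value at [ord0] and a function
    on ['I_n]. *)
Lemma multilinear_sum (T : finType) (f : vform V) n (h : 'I_n -> T -> V) :
    multilinear f ->
  \sum_(t : {ffun 'I_n -> T}) f [seq h i (t i) | i <- enum 'I_n]
  = f [seq \sum_t h i t | i <- enum 'I_n].
Proof.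
elim: n f h => [|n IHn] f h lf.
  have e0 : enum 'I_0 = [::] by apply: size0nil; rewrite size_enum_ord.
  by rewrite e0 /= sumr_const card_ffun card_ord expn0.
pose U := HB.pack
  (fun x => f (x :: [seq \sum_t h (lift ord0 i) t | i <- enum 'I_n]))
  (@GRing.isLinear.Build K V V *:%R _ (lf [::] _)) : {linear V -> V}.
transitivity (U (\sum_t h ord0 t)); last first.
  by rewrite [enum 'I_n.+1]enum_ordSl /= -map_comp.
rewrite linear_sum /=.
transitivity (\sum_x \sum_(t : {ffun 'I_n -> T})
    f (h ord0 x :: [seq h (lift ord0 i) (t i) | i <- enum 'I_n])); last first.
  apply: eq_bigr => x _.
  apply: (IHn (fun X => f (h ord0 x :: X)) (fun i => h (lift ord0 i))) => A B.
  exact: (lf (h ord0 x :: A) B).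
rewrite pair_big /=.
pose cons_ffun (q : T * {ffun 'I_n -> T}) : {ffun 'I_n.+1 -> T} :=
  [ffun i => oapp q.2 q.1 (unlift ord0 i)].
pose uncons_ffun (t : {ffun 'I_n.+1 -> T}) :=
  (t ord0, [ffun i => t (lift ord0 i)] : {ffun 'I_n -> T}).
rewrite (reindex cons_ffun); last first.
  exists uncons_ffun => [[x t] _|t _].
    congr (_, _); first by rewrite ffunE unlift_none.
    by apply/ffunP => i; rewrite !ffunE liftK.
  apply/ffunP => i; rewrite ffunE.
  by case: unliftP => [j|] -> //=; rewrite ffunE.
apply: eq_bigr => -[x t] _; rewrite [enum 'I_n.+1]enum_ordSl /= -map_comp.
rewrite ffunE unlift_none; congr (f (_ :: _)); apply: eq_map => i /=.
by rewrite ffunE liftK.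
Qed.

(** The left-hand side is the sum over families of degrees in an insertion, once
    the Koszul sign has been absorbed. *)
Lemma multilinear_gcomp (f : vform V) X : multilinear f ->
  \sum_(d \in [set: {ffun 'I_(size X) -> int}]%classic)
     f [seq gcomp E (d i) X`_i | i <- enum 'I_(size X)] = f X.
Proof.
move=> lf; have [J hJ] := common_degrees X.
pose h (t : {ffun 'I_(size X) -> seq_sub J}) :=
  [ffun i => val (t i)] : {ffun 'I_(size X) -> int}.
rewrite (fsbig_finite_support (h := h)).
- under eq_bigr => t _ do under eq_map => i do rewrite ffunE.
  rewrite (multilinear_sum (fun i t => gcomp E (val t) X`_i) lf); congr f.
  rewrite -[RHS](mkseq_nth 0) /mkseq -val_enum_ord -map_comp.
  apply: eq_map => i /=; apply: gcomp_sum_degrees => j.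
  by apply: hJ; apply: mem_nth.
- move=> t1 t2 /ffunP e; apply/ffunP => i; apply: val_inj.
  by have := e i; rewrite !ffunE.
- move=> d nz; have dJ i : d i \in J.
    apply: (hJ X`_i); first exact: mem_nth.
    apply: contraNneq nz => z; rewrite multilinear_mem0//.
    by apply/mapP; exists i => //; rewrite mem_enum.
  by exists [ffun i => SeqSub (dJ i)]; apply/ffunP => i; rewrite !ffunE.
Qed.

(** * Unshuffles and Koszul signs *)

Lemma graded_symmetric_front (f : vform V) (A : seq (int * V)) i x B :
    graded_symmetric E f -> homog E i x ->
    {in A, forall q, homog E q.1 q.2} ->
  f ([seq q.2 | q <- A] ++ x :: B)
  = (\prod_(q <- A) (-1) ^ (i * q.1)) *: f (x :: [seq q.2 | q <- A] ++ B).
Proof.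
move=> + hx; elim: A f => [|q A IHA] f sf hA; first by rewrite big_nil scale1r.
have sfq : graded_symmetric E (fun X => f (q.2 :: X)).
  by move=> X Y j k u v hu hv; exact: (sf (q.2 :: X)).
have hq : homog E q.1 q.2 by apply: hA; rewrite mem_head.
rewrite /= (IHA (fun X => f (q.2 :: X))) //; last first.
  by move=> r rA; apply: hA; rewrite inE rA orbT.
by rewrite (sf [::] _ _ _ _ _ hq hx) scalerA big_cons mulrC (mulrC q.1).
Qed.

Lemma ltn_val_trans n : transitive (relpre (val : 'I_n -> nat) ltn).
Proof. by move=> j i k; exact: ltn_trans. Qed.

Lemma sorted_enum_ord n : sorted (relpre val ltn) (enum 'I_n).
Proof. by rewrite -sorted_map val_enum_ord iota_ltn_sorted. Qed.

Lemma ord_sorted_eq n (A B : seq 'I_n) :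
  sorted (relpre val ltn) A -> sorted (relpre val ltn) B -> A =i B -> A = B.
Proof.
by apply: irr_sorted_eq; [exact: ltn_val_trans | move=> i /=; exact: ltnn].
Qed.

Lemma sorted_map_enum_ord m n (h : 'I_m -> 'I_n) :
    (forall i j : 'I_m, i < j -> h i < h j)%N ->
  sorted (relpre val ltn) [seq h i | i <- enum 'I_m].
Proof.
move=> mh; rewrite sorted_map; apply: sub_sorted (sorted_enum_ord m) => i j.
exact: mh.
Qed.

Lemma increasing_perm1 n (s : 'S_n) :
  (forall i j : 'I_n, i < j -> s i < s j)%N -> s = 1%g.
Proof.
move=> /sorted_map_enum_ord/ord_sorted_eq/(_ (sorted_enum_ord n)) es.
apply/permP => i; rewrite perm1.
have /eq_in_map : map s (enum 'I_n) = map id (enum 'I_n).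
  rewrite map_id; apply: es => j; rewrite mem_enum -(permKV s j).
  by rewrite map_f// mem_enum.
by apply; rewrite mem_enum.
Qed.

Lemma unshuffle0 n (s : 'S_n) : unshuffle 0 s = (s == 1%g).
Proof.
apply/idP/eqP => [/forallP us|->]; last first.
  apply/forallP => i; apply/forallP => j; rewrite !perm1 ltn0 andbF.
  exact/implyP.
apply: increasing_perm1 => i j ij; have /forallP/(_ j)/implyP := us i.
by apply; rewrite ij orbT.
Qed.

Lemma unshuffle_size n (s : 'S_n) : unshuffle n s = (s == 1%g).
Proof.
apply/idP/eqP => [/forallP us|->]; last first.
  apply/forallP => i; apply/forallP => j; rewrite !perm1; apply/implyP.
  by case/orP=> /andP[// + _]; rewrite leqNgt ltn_ord.
apply: increasing_perm1 => i j ij; have /forallP/(_ j)/implyP := us i.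
by apply; rewrite ij ltn_ord.
Qed.

Lemma unshuffle1P n (s : 'S_n.+1) :
  reflect (forall i j : 'I_n.+1, 0 < i < j -> s i < s j)%N (unshuffle 1 s).
Proof.
apply: (iffP forallP) => [us i j ij|us i].
  by have /forallP/(_ j)/implyP := us i; apply; rewrite ij orbT.
apply/forallP => j; apply/implyP => /orP[|/us//].
by case/andP=> /leq_trans/[apply].
Qed.

(** Both lists of remaining indices are increasing and have the same elements. In
    particular the unshuffle is determined by the index pulled to the front. *)
Lemma unshuffle1_enum n (s : 'S_n.+1) : unshuffle 1 s ->
  [seq s i | i <- enum 'I_n.+1]
  = s ord0 :: [seq j <- enum 'I_n.+1 | j != s ord0].
Proof.
move=> /unshuffle1P us; rewrite [in LHS]enum_ordSl /= -map_comp; congr cons.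
apply: ord_sorted_eq.
- by apply: sorted_map_enum_ord => i j ij; apply: us.
- exact: sorted_filter (@ltn_val_trans _) _ _ (sorted_enum_ord _).
move=> j; rewrite mem_filter mem_enum andbT.
apply/mapP/idP => [[i _ ->]|]; first by rewrite (inj_eq perm_inj).
rewrite -(permKV s j) (inj_eq perm_inj).
case: (unliftP ord0 (s^-1 j)%g) => [i ->|->]; last by rewrite eqxx.
by exists i; rewrite ?mem_enum.
Qed.

Lemma card_unshuffle1 n : #|[set s : 'S_n.+1 | unshuffle 1 s]| = n.+1.
Proof.
rewrite -[RHS]card_ord -cardsT.
rewrite -(@card_in_imset _ _ (fun s : 'S_n.+1 => s ord0)); last first.
  move=> s t; rewrite !inE => /unshuffle1_enum us /unshuffle1_enum ut e.
  apply/permP => i.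
  have /eq_in_map : map s (enum 'I_n.+1) = map t (enum 'I_n.+1).
    by rewrite us ut e.
  by apply; rewrite mem_enum.
apply: eq_card => i; rewrite inE; apply/imsetP.
(* The unshuffle that pulls [i] to the front. *)
exists (lift_perm ord0 i 1); last by rewrite lift_perm_id.
rewrite inE; apply/unshuffle1P => a b /andP[a0 ab].
case: (unliftP ord0 a) a0 ab => [a' ->|->]; last by rewrite ltnn.
case: (unliftP ord0 b) => [b' ->|->] _; last by rewrite ltn0.
rewrite !lift_perm_lift !perm1 /= /bump !leq0n !add1n ltnS.
by case: leqP; case: leqP => //=; lia.
Qed.

(** The only inversions of such an unshuffle are between the index pulled to the
    front and the smaller indices. *)
Lemma koszul_unshuffle1 n (d : 'I_n.+1 -> int) (s : 'S_n.+1) : unshuffle 1 s ->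
  koszul K d s = \prod_(j < n.+1 | (j < s ord0)%N) (-1) ^ (d (s ord0) * d j).
Proof.
move=> /unshuffle1P us; rewrite /koszul (bigD1 ord0)//= [X in _ * X]big1 ?mulr1.
  rewrite [RHS](reindex_inj (@perm_inj _ s)); apply: eq_bigl => j.
  rewrite lt0n andb_idl//; apply: contraTneq => j0.
  have -> : j = ord0 by apply: val_inj.
  by rewrite ltnn.
move=> i i0; rewrite big_pred0// => j; apply/negbTE/negP => /andP[ij].
by rewrite ltnNge ltnW// us// ij lt0n i0.
Qed.

(** The Koszul sign is the one produced by graded symmetry when the argument
    pulled to the front jumps over those that preceded it. *)
Lemma koszul_unshuffle1_symmetric n (f : vform V) (d : 'I_n -> int)
    (y : 'I_n -> V) (s : 'S_n) :
    graded_symmetric E f -> (forall i, homog E (d i) (y i)) -> unshuffle 1 s ->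
  koszul K d s *: f [seq y (s i) | i <- enum 'I_n]
  = f [seq y i | i <- enum 'I_n].
Proof.
case: n => [|n] in d y s *.
  by rewrite /koszul big_ord0 scale1r (size0nil (size_enum_ord 0)).
move=> sf hy us; rewrite koszul_unshuffle1//.
rewrite (map_comp y s) (unshuffle1_enum us).
move: (s ord0) => {us}i.
have -> : \prod_(j < n.+1 | (j < i)%N) (-1) ^ (d i * d j)
    = \prod_(j <- enum 'I_n.+1 | (j < i)%N) (-1) ^ (d i * d j) :> K.
  by rewrite big_enum_cond.
(* Cut the arguments at [i]: by monotonicity [A] consists of the indices below
   [i], over which the sign ranges, and [B] of those above. *)
have := sorted_enum_ord n.+1.
have : uniq (enum 'I_n.+1) := enum_uniq _.
have : i \in enum 'I_n.+1 by rewrite mem_enum.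
case/splitPr => A B; rewrite cat_uniq /= => /and3P[_ /norP[iA _] /andP[iB _]].
rewrite (sorted_pairwise (@ltn_val_trans _)).
rewrite pairwise_cat /= => /and3P[/allrelP AB _ /andP[/allP Bi _]].
have Ai j : j \in A -> (j < i)%N.
  by move=> jA; apply: AB => //; rewrite mem_head.
have nA : [seq j <- A | j != i] = A.
  by apply/all_filterP/allP => j jA; apply: contraNneq iA => <-.
have nB : [seq j <- B | j != i] = B.
  by apply/all_filterP/allP => j jA; apply: contraNneq iB => <-.
rewrite filter_cat /= eqxx nA nB !map_cat /=.
have := @graded_symmetric_front f [seq (d j, y j) | j <- A] (d i) (y i)
  [seq y j | j <- B] sf (hy i).
rewrite -map_comp big_map => -> => [|q /mapP[j _ ->]]; last exact: hy.
rewrite big_cat big_cons /= ltnn [X in _ * X]big1_seq ?mulr1; last first.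
  by move=> j /andP[ji /Bi /=]; rewrite ltnNge ltnW.
congr (_ *: _); rewrite big_seq_cond [RHS]big_seq; apply: eq_bigl => j.
by apply: andb_idr => /Ai.
Qed.

Lemma koszul1 n (d : 'I_n -> int) : koszul K d 1%g = 1.
Proof.
rewrite /koszul big1// => i _; rewrite big_pred0// => j; rewrite !perm1.
by case: ltngtP.
Qed.

(** * The bracket with the identity plus a constant *)

Section IdConst.
Variable p : V.
Local Notation N := (form1 id \+ form0 p : vform V).

Lemma id_const_size2 X : (1 < size X)%N -> form1 id X + form0 p X = 0.
Proof. by case: X => [|x [|y X]]//= _; exact: addr0. Qed.

(** In the sum over the size [k] of the block fed to [Id + p], the term [k = 0]
    is the insertion of [p]; the term [k = 1] has [size X] unshuffles, each
    contributing [f X]; and [Id + p] has no components of higher arity. *)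
Lemma insertion_id_const f X : multilinear f -> graded_symmetric E f ->
  insertion E N f X = f (p :: X) + f X *+ size X.
Proof.
move=> lf sf; rewrite /insertion big_ord_recl /=; congr (_ + _).
  under eq_bigl => s do rewrite unshuffle0.
  rewrite big_pred1_eq.
  rewrite -(multilinear_gcomp (f := fun Y => f (p :: Y))); last first.
    by move=> A B; exact: (lf (p :: A) B).
  apply: eq_fsbigr => d _; rewrite koszul1 scale1r take0 drop0 /= add0r.
  by congr (f (_ :: _)); apply: eq_map => i; rewrite perm1.
case: (posnP (size X)) => [X0|X_gt0]; first by rewrite X0 mulr0n big_ord0.
rewrite (bigD1 (Ordinal X_gt0))//= [X in _ + X]big1 ?addr0; last first.
  move=> k k0; apply: big1 => s _; apply: fsbig1 => d _.
  rewrite id_const_size2 ?(multilinear0 [::]) ?scaler0//.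
  rewrite size_take size_map size_enum_ord.
  have kX := ltn_ord k; have k_gt0 : (0 < k)%N by rewrite lt0n.
  by rewrite /bump /=; case: ifP => //; lia.
rewrite (eq_bigr (fun=> f X)) => [|s us]; last first.
  rewrite -[RHS](multilinear_gcomp X lf).
  apply: eq_fsbigr => d _.
  rewrite -(koszul_unshuffle1_symmetric (d := d) sf _ us); last first.
    by move=> i; exact: homog_gcomp.
  congr (_ *: f _).
  case E0 : [seq _ | i <- _] => [|x Y] /=; last by rewrite addr0 take0 drop0.
  have := congr1 size E0; rewrite size_map size_enum_ord /= => X0.
  by rewrite X0 in X_gt0.
rewrite sumr_const; congr (_ *+ _).
case: (size X) X_gt0 => // n _; rewrite -[RHS]card_unshuffle1.
by apply: eq_card => s; rewrite inE.
Qed.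

(** Only the block made of all the arguments contributes: [Id] takes exactly one
    argument, and the constant [p] none. *)
Lemma insertion_into_id_const f X : multilinear f -> insertion E f N X = f X.
Proof.
move=> lf; rewrite /insertion big_ord_recr /= big1 ?add0r; last first.
  move=> k _; apply: big1 => s _; apply: fsbig1 => d _.
  rewrite /=; set Y := map _ _; have : (1 < size (f (take k Y) :: drop k Y))%N.
    by rewrite /= size_drop size_map size_enum_ord; have := ltn_ord k; lia.
  by move=> /id_const_size2 /= ->; rewrite scaler0.
under eq_bigl => s do rewrite unshuffle_size.
rewrite big_pred1_eq -[RHS](multilinear_gcomp X lf).
apply: eq_fsbigr => d _; rewrite koszul1 scale1r.
set Y := map _ _; have sY : size Y = size X by rewrite size_map size_enum_ord.
rewrite take_oversize ?sY// drop_oversize ?sY//= addr0; congr f.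
by apply: eq_map => i; rewrite perm1.
Qed.

Lemma rn_bracket_id_const b f X : multilinear f -> graded_symmetric E f ->
  rn_bracket E 0 b N f X = f (p :: X) + f X *+ size X - f X.
Proof.
move=> lf sf; rewrite /rn_bracket insertion_id_const//.
by rewrite insertion_into_id_const// mul0r expr0z scale1r.
Qed.
End IdConst.

(** * Symmetric forms of arity at most two *)

Lemma svformD a (f g : vform V) :
  svform E a f -> svform E a g -> svform E a (f \+ g).
Proof.
move=> [lf sf df] [lg sg dg]; split=> [X Y c x y|X Y i j x y hx hy|s hs] /=.
- by rewrite lf lg scalerDr addrACA.
- by rewrite (sf _ _ _ _ _ _ hx hy) (sg _ _ _ _ _ _ hx hy) scalerDr.
- by rewrite /homog/= linearD /= (df s hs) (dg s hs).
Qed.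

Lemma homog0 i : homog E i 0.
Proof. by rewrite /homog/= linear0. Qed.

Lemma svform_form0 a c : homog E a c -> svform E a (form0 c).
Proof.
move=> hc; split=> [X Y k x y|X Y i j x y _ _|[|q s] hs] /=.
- by case: X => [|? ?]/=; rewrite scaler0 addr0.
- by case: X => [|? ?]/=; rewrite scaler0.
- by rewrite big_nil add0r.
- exact: homog0.
Qed.

Lemma svform_form1 a (u : V -> V) : linear u ->
  (forall i x, homog E i x -> homog E (i + a) (u x)) -> svform E a (form1 u).
Proof.
move=> lu du; split=> [X Y k x y|X Y i j x y _ _|[|q [|r s]] hs] /=.
- case: X => [|x1 [|? ?]]/=; rewrite ?scaler0 ?addr0 //.
  by case: Y => [|? ?] /=; [exact: lu | rewrite scaler0 addr0].
- by case: X => [|? [|? ?]] /=; rewrite scaler0.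
- exact: homog0.
- by rewrite big_seq1; apply: du; apply: hs; rewrite mem_head.
- exact: homog0.
Qed.

Lemma svform_form2 a (b : V -> V -> V) :
    (forall y, linear (b^~ y)) -> (forall x, linear (b x)) ->
    (forall i j x y, homog E i x -> homog E j y ->
       homog E (i + j + a) (b x y)) ->
    (forall i j x y, homog E i x -> homog E j y ->
       b x y = (-1) ^ (i * j) *: b y x) ->
  svform E a (form2 b).
Proof.
move=> ll lr db sb.
split=> [X Y k x y|X Y i j x y hx hy|[|q [|r [|s0 s]]] hs] /=.
- case: X => [|x1 [|x2 [|? ?]]]/=; rewrite ?scaler0 ?addr0 //.
    case: Y => [|y1 [|? ?]] /=; rewrite ?scaler0 ?addr0//.
    exact: (ll y1).
  by case: Y => [|? ?] /=; [exact: lr | rewrite scaler0 addr0].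
- case: X => [|? [|? [|? ?]]] /=; rewrite ?scaler0//.
  by case: Y => [|? ?]; [exact: sb | rewrite scaler0].
- exact: homog0.
- exact: homog0.
- rewrite big_cons big_seq1.
  by apply: db; apply: hs; rewrite !inE eqxx ?orbT.
- exact: homog0.
Qed.

Lemma svform_lie (l2 : V -> V -> V) :
  symmetric_graded_lie E l2 -> svform E 1 (form2 l2).
Proof. by case=> *; apply: svform_form2. Qed.

(** * Deformation of a symmetric DGLA structure *)

Section DGLA.
Variables (l1 : V -> V) (l2 : V -> V -> V) (p : V).
Hypotheses (dgla : symmetric_dgla E l1 l2) (p0 : homog E 0 p).

Let lie := dgla_lie dgla.
Local Notation mu := (form1 l1 \+ form2 l2 : vform V).
Local Notation N := (form1 id \+ form0 p : vform V).

Lemma linear_of_degree1_ad : linear_of_degree1 E (l2 p).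
Proof.
split=> [|i x hx]; first exact: (lie_linearr lie).
by have := lie_degree lie p0 hx; rewrite add0r.
Qed.

Lemma homog_curvature : homog E 1 (l1 p).
Proof. exact: ((dgla_differential dgla).2 0). Qed.

Lemma svform_dgla : svform E 1 mu.
Proof.
have [l1l l1d] := dgla_differential dgla.
by apply: svformD; [apply: svform_form1 | exact: svform_lie].
Qed.

Lemma svform_id_const : svform E 0 N.
Proof.
apply: svformD; last exact: svform_form0.
by apply: svform_form1 => // i x; rewrite addr0.
Qed.

Lemma deformed_structure :
  rn_bracket E 0 1 N mu = form0 (l1 p) \+ form1 (l2 p) \+ form2 l2.
Proof.
have [lm sm _] := svform_dgla; apply/funext => X.
rewrite rn_bracket_id_const//; case: X => [|x [|y [|z X]]] /=.
- by rewrite mulr0n !addr0 subr0.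
- by rewrite mulr1n !addr0 add0r addrK.
- by rewrite !add0r mulr2n addrK.
- by rewrite !(addr0, mul0rn, subr0).
Qed.

Lemma svform_deformed :
  svform E 1 (form0 (l1 p) \+ form1 (l2 p) \+ form2 l2).
Proof.
have [lp dp] := linear_of_degree1_ad.
apply: svformD; last exact: svform_lie.
by apply: svformD; [exact: svform_form0 homog_curvature | exact: svform_form1].
Qed.

Lemma twice_deformed_structure :
  rn_bracket E 0 1 N (rn_bracket E 0 1 N mu)
  = form0 (l2 p p - l1 p) \+ form1 (l2 p) \+ form2 l2.
Proof.
have [lm sm _] := svform_deformed; apply/funext => X.
rewrite deformed_structure rn_bracket_id_const//.
case: X => [|x [|y [|z X]]] /=.
- by rewrite mulr0n !addr0 add0r.
- by rewrite mulr1n !addr0 !add0r addrK.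
- by rewrite !add0r mulr2n addrK.
- by rewrite !(addr0, mul0rn, subr0).
Qed.

Lemma maurer_cartanE : maurer_cartan l1 l2 p <-> l2 p p - l1 p = l1 p.
Proof.
have two0 : 2 != 0 :> K by rewrite pnatr_eq0.
rewrite /maurer_cartan; split=> [/eqP|/eqP].
  rewrite subr_eq0 => /eqP ->; rewrite -[X in X - _]scale1r -scalerBl.
  congr (_ *: _); apply: (mulfI two0).
  by rewrite mulrBr divff// mulr1 -[2]/(1 + 1) addrK.
rewrite subr_eq => /eqP ->.
by rewrite -mulr2n -scaler_nat scalerA mulVf// scale1r subrr.
Qed.

Lemma nijenhuis_id_const :
  nijenhuis_with_curvature E mu N N p <-> maurer_cartan l1 l2 p.
Proof.
rewrite maurer_cartanE; split=> [[nij _]|mc].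
  have := nijenhuis_deform nij [::].
  by rewrite twice_deformed_structure deformed_structure /= !addr0.
split; last by rewrite /= add0r.
have NN := svform_id_const; split=> //; first exact: svform_dgla.
  by move=> X; rewrite twice_deformed_structure deformed_structure mc.
by move=> X; rewrite /rn_bracket mul0r expr0z scale1r subrr.
Qed.

(** Since [p] has degree 0, the Jacobi identity makes [l2 p] a derivation of
    [l2], up to the sign conventions of symmetric brackets. *)
Lemma lie_jacobi_const i j x y : homog E i x -> homog E j y ->
  l2 p (l2 x y) + l2 (l2 p x) y + (-1) ^ i *: l2 x (l2 p y) = 0.
Proof.
move=> hx hy; have := lie_jacobi lie p0 hx hy.
rewrite mul0r expr0z scale1r.
rewrite (lie_symmetric lie (lie_degree lie hx hy) p0) mulr0 expr0z scale1r.
rewrite (lie_symmetric lie (lie_degree lie p0 hy) hx) scalerA add0r.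
rewrite mulrDl mul1r (mulrC j) expfzDr ?oppr_eq0 ?oner_eq0//.
rewrite mulrA -expfzMl mulrNN mulr1 exp1rz mul1r => <-.
by rewrite -addrA addrC.
Qed.

Lemma curved_structure : maurer_cartan l1 l2 p ->
  curved_symmetric_dgla E (l1 p) (l2 p) l2.
Proof.
have two0 : 2 != 0 :> K by rewrite pnatr_eq0.
have lr := lie_linearr lie; have ll := lie_linearl lie.
move=> /eqP; rewrite subr_eq0 => /eqP mc.
(* The Jacobi identity for [p], [p] and [x]. *)
have jac2 i x : homog E i x -> l2 (l2 p p) x = - (l2 p (l2 p x) *+ 2).
  move=> hx; have := lie_jacobi_const p0 hx; rewrite expr0z scale1r.
  by rewrite addrAC -mulr2n => /eqP; rewrite addr_eq0 eq_sym eqr_oppLR => /eqP.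
split; [exact: homog_curvature|exact: linear_of_degree1_ad|exact: lie|..].
- rewrite mc (GRing.scalable_linear (lr p)); apply/eqP; rewrite scaler_eq0.
  apply/orP; right; have hpp : homog E 1 (l2 p p) := lie_degree lie p0 p0.
  have := jac2 _ _ p0; rewrite (lie_symmetric lie hpp p0) mulr0 expr0z scale1r.
  (* The identity [jac2] at [p] now reads [3 l2(p, l2(p, p)) = 0]. *)
  move/eqP; rewrite -addr_eq0 -mulrS -scaler_nat scaler_eq0.
  by rewrite pnatr_eq0.
- apply: (linear_homog0 (u := fun x => l2 (l1 p) x + l2 p (l2 p x))).
    by move=> k x y; rewrite !lr scalerDr addrACA.
  move=> i x hx; rewrite mc (GRing.scalable_linear (ll x)) (jac2 i)//=.
  by rewrite scalerN -scaler_nat scalerA mulVf// scale1r addNr.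
- move=> i x y hx; move: y.
  apply: (linear_homog0 (u := fun y =>
    l2 p (l2 x y) + l2 (l2 p x) y + (-1) ^ i *: l2 x (l2 p y))).
    move=> k y z; rewrite !lr !scalerDr !scalerA [_ * k]mulrC -!scalerA.
    by rewrite (addrACA (k *: l2 p (l2 x y))) [LHS]addrACA.
  by move=> j y hy; exact: (lie_jacobi_const hx hy).
Qed.
End DGLA.
End Grading.

Theorem corollary2p4p12 (R : realType) (c : scalar_kind)
    (V : lmodType (scalars R c)) (E : grading V)
    (l1 : V -> V) (l2 : V -> V -> V) (p : V)
    (dgla : symmetric_dgla E l1 l2) (p0 : homog E 0 p) :
  let mu : vform V := form1 l1 \+ form2 l2 in
  let N : vform V := form1 id \+ form0 p in
  (nijenhuis_with_curvature E mu N N p <-> maurer_cartan l1 l2 p) /\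
  (maurer_cartan l1 l2 p ->
     rn_bracket E 0 1 N mu =1 form0 (l1 p) \+ form1 (l2 p) \+ form2 l2 /\
     curved_symmetric_dgla E (l1 p) (l2 p) l2).
Proof.
move=> mu N; split; first exact: nijenhuis_id_const.
move=> mc; split; last exact: (curved_structure dgla p0).
by rewrite /mu /N deformed_structure.
Qed.
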